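(* Fix $\bar\theta\in\mathcal P$ and write $K,M,D,\eta,\rho$ for $K(\bar\theta),M(\bar\theta),D(\bar\theta),\eta(\bar\theta),\rho(\bar\theta)$. For $(C,A)$ with $C>0$, $A\ge0$, $C+A<1$, define $$q(C,A):=1-C-A,\qquad B(C,A):=M^{-1}(CK+AD).$$ Whenever $\lambda_{\mathrm{PF}}(B(C,A))=1$, let $u(C,A)\gg0$ denote the corresponding Perron eigenvector normalised by $\mathbf 1^\top u(C,A)=1$. Then a point $(L^*,R^*,A^* )\in\mathcal T$ with $$L^*>0,\qquad R^*>0,\qquad C^*:=1-L^*-R^*-A^*>0$$ is an equilibrium of the frozen system $$\dot v=(CK+AD-M)v,\qquad \dot A=\eta C-A\,\mathbf 1^\top Dv-\rho A,\qquad C=1-\mathbf 1^\top v-A,\qquad v=(L,R)^\top,$$ if and only if $$\lambda_{\mathrm{PF}}\bigl(B(C^*,A^* )\bigr)=1$$ and $$\eta C^*=A^*\Bigl[\rho+q(C^*,A^* )\,\mathbf 1^\top D\,u(C^*,A^* )\Bigr],$$ with $$\binom{L^*}{R^*}=q(C^*,A^* )\,u(C^*,A^* ).$$ In particular, every positive frozen equilibrium lies on the surface $\lambda_{\mathrm{PF}}(B(C^*,A^* ))=1$, and the remaining equilibrium condition reduces to the displayed scalar relation for $\eta C^*$. These two equations form a closed system for the two unknowns $(C^*,A^* )$; once a pair satisfying both is found, the radical shares $(L^*,R^* )$ are recovered from the last displayed formula.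
   Context: The state space is the simplex $\mathcal T=\{(L,R,A)\in\mathbb R^3: L\ge0,R\ge0,A\ge0,L+R+A\le1\}$. Parameters are $\theta=(\alpha_L,\alpha_R,\gamma_{LR},\gamma_{RL},\mu_L,\mu_R,\delta_L,\delta_R,\eta,\rho)\in\mathcal P$, where $\mathcal P\subset\mathbb R^{10}$ is a compact convex set all of whose points have strictly positive entries. For $\theta\in\mathcal P$, $$K(\theta)=\begin{pmatrix}\alpha_L&\gamma_{RL}\\ \gamma_{LR}&\alpha_R\end{pmatrix},\quad M(\theta)=\begin{pmatrix}\mu_L&0\\0&\mu_R\end{pmatrix},\quad D(\theta)=\begin{pmatrix}\delta_L&0\\0&\delta_R\end{pmatrix},$$ and $\eta(\theta),\rho(\theta)$ are the last two components. $\mathbf 1=(1,1)^\top$. $\lambda_{\mathrm{PF}}(B)$ denotes the Perron--Frobenius eigenvalue (spectral radius) of a matrix $B$ with strictly positive entries, and $u\gg0$ means that all entries of $u$ are strictly positive. A positive frozen equilibrium is an equilibrium $(L^*,R^*,A^* )\in\mathcal T$ of the frozen system with $L^*>0$, $R^*>0$, $C^*>0$. *)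

(* Defs.v *)
From HB Require Import structures.
From mathcomp Require Import all_boot all_order all_algebra.
From mathcomp Require Import complex.
From mathcomp Require Import all_classical all_reals all_analysis.

Set Implicit Arguments.
Unset Strict Implicit.
Unset Printing Implicit Defensive.

Import Order.TTheory GRing.Theory Num.Theory.
Import numFieldNormedType.Exports.

Local Open Scope classical_set_scope.
Local Open Scope ring_scope.

(* [eigenvalue] uses row eigenvectors; a square matrix and its transpose have
   the same eigenvalues. *)
Definition complex_spectrum (R : realType) n (B : 'M[R]_n) : set R[i] :=
  [set z | eigenvalue (map_mx (real_complex R) B) z].

(* Spectral radius.  The spectrum is finite, and nonempty when [0 < n], so the
   supremum is then a maximum. *)
Definition lambda_PF (R : realType) n (B : 'M[R]_n) : R :=
  sup [set Normc.normc z | z in complex_spectrum B].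

Definition ones (R : realType) n : 'cV[R]_n := const_mx 1.

Definition entrysum (R : realType) n (u : 'cV[R]_n) : R :=
  ((ones R n)^T *m u) ord0 ord0.

Definition is_perron_vector (R : realType) n (B : 'M[R]_n) (u : 'cV[R]_n) :
  Prop :=
  [/\ B *m u = lambda_PF B *: u,
      forall i, 0 < u i ord0
    & entrysum u = 1].

(* The junk value 0 is returned when [B] has no such vector. *)
Definition perron_vector (R : realType) n (B : 'M[R]_n) : 'cV[R]_n :=
  xget 0 [set u | is_perron_vector B u].

Definition mx2 (R : realType) (a b c d : R) : 'M[R]_2 :=
  \matrix_(i, j) if i == ord0 then (if j == ord0 then a else b)
                 else (if j == ord0 then c else d).

Definition cv2 (R : realType) (a b : R) : 'cV[R]_2 :=
  \col_i if i == ord0 then a else b.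

Definition param (R : realType) := 'rV[R]_10.

Definition alpha_L (R : realType) (theta : param R) : R :=
  theta ord0 (inord 0).
Definition alpha_R (R : realType) (theta : param R) : R :=
  theta ord0 (inord 1).
Definition gamma_LR (R : realType) (theta : param R) : R :=
  theta ord0 (inord 2).
Definition gamma_RL (R : realType) (theta : param R) : R :=
  theta ord0 (inord 3).
Definition mu_L (R : realType) (theta : param R) : R :=
  theta ord0 (inord 4).
Definition mu_R (R : realType) (theta : param R) : R :=
  theta ord0 (inord 5).
Definition delta_L (R : realType) (theta : param R) : R :=
  theta ord0 (inord 6).
Definition delta_R (R : realType) (theta : param R) : R :=
  theta ord0 (inord 7).
Definition eta_of (R : realType) (theta : param R) : R :=
  theta ord0 (inord 8).
Definition rho_of (R : realType) (theta : param R) : R :=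
  theta ord0 (inord 9).

Definition Kmx (R : realType) (theta : param R) : 'M[R]_2 :=
  mx2 (alpha_L theta) (gamma_RL theta) (gamma_LR theta) (alpha_R theta).
Definition Mmx (R : realType) (theta : param R) : 'M[R]_2 :=
  mx2 (mu_L theta) 0 0 (mu_R theta).
Definition Dmx (R : realType) (theta : param R) : 'M[R]_2 :=
  mx2 (delta_L theta) 0 0 (delta_R theta).

(* States are triples (L, R, A); below l, r, a, c stand for L, R, A, C. *)
Definition simplex (R : realType) : set (R * R * R) :=
  [set x | let: (l, r, a) := x in [/\ 0 <= l, 0 <= r, 0 <= a & l + r + a <= 1]].

Definition frozen_field (R : realType) (theta : param R) (x : R * R * R) :
  'cV[R]_2 * R :=
  let: (l, r, a) := x in
  let v := cv2 l r in
  let c := 1 - entrysum v - a in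
  ((c *: Kmx theta + a *: Dmx theta - Mmx theta) *m v,
   eta_of theta * c - a * entrysum (Dmx theta *m v) - rho_of theta * a).

Definition frozen_equilibrium (R : realType) (theta : param R) (x : R * R * R) :
  Prop :=
  frozen_field theta x = (0, 0).

Definition positive_frozen_equilibrium (R : realType) (theta : param R) (x : R * R * R) :
  Prop :=
  let: (l, r, a) := x in
  [/\ simplex x, frozen_equilibrium theta x, 0 < l, 0 < r & 0 < 1 - l - r - a].

Definition admissible (R : realType) (c a : R) : Prop :=
  [/\ 0 < c, 0 <= a & c + a < 1].

Definition qCA (R : realType) (c a : R) : R := 1 - c - a.

Definition BCA (R : realType) (theta : param R) (c a : R) : 'M[R]_2 :=
  invmx (Mmx theta) *m (c *: Kmx theta + a *: Dmx theta).

Definition uCA (R : realType) (theta : param R) (c a : R) : 'cV[R]_2 :=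
  perron_vector (BCA theta c a).

Definition scalar_relation (R : realType) (theta : param R) (c a : R) : Prop :=
  eta_of theta * c =
  a * (rho_of theta + qCA c a * entrysum (Dmx theta *m uCA theta c a)).

(* Main.v *)
Require Import Defs.
From HB Require Import structures.
From mathcomp Require Import all_boot all_order all_algebra.
From mathcomp Require Import complex.
From mathcomp Require Import all_classical all_reals all_analysis.
From mathcomp Require Import ring lra.
Import Order.TTheory GRing.Theory Num.Theory.
Import numFieldNormedType.Exports.
Local Open Scope classical_set_scope.
Local Open Scope ring_scope.

(** The proof rests on Perron--Frobenius theory for the matrix [B = B(C,A)],
    which has strictly positive entries because [C > 0], [A >= 0] and all
    parameters are strictly positive.

    Two facts are needed.  First, an entrywise nonnegative matrix with an
    entrywise positive eigenvector [u] has the eigenvalue of [u] as its spectral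
    radius ([lambda_PF_pos_eigenvector]): if [w] is a complex row eigenvector for
    [z], pairing the inequality [|z| |w| <= |w| B] with [u] gives
    [|z| <= lambda].  Second, a [2 x 2] matrix with positive entries has exactly
    one normalised positive eigenvector ([perron_vector2_unique]): existence
    comes from the quadratic formula for the larger root of the characteristic
    polynomial, uniqueness from the first row of the eigenvector equation, which
    fixes the ratio of the two entries.

    Since [M] is invertible, [(C K + A D - M) v = 0] is equivalent to [B v = v].
    A positive solution [v] is thus a positive eigenvector for the eigenvalue
    [1], so that the spectral radius is [1] and [v] is the multiple of the Perron
    vector with total mass [1' v = L + R = q(C,A)].  Substituting [v = q u] turns
    the equation for [A] into the scalar relation, and all the steps are
    reversible. *)

(** * Nonnegative matrices with a positive eigenvector *)

(** [eigenvalue] is defined by row eigenvectors. *)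
Lemma eigenvalue_col {F : fieldType} {n} {B : 'M[F]_n} {u : 'cV[F]_n} {a : F} :
  u != 0 -> B *m u = a *: u -> eigenvalue B a.
Proof.
move=> u0 Bu; rewrite /eigenvalue /eigenspace kermx_eq0 row_free_unit.
apply: contra u0 => Bunit; rewrite -(mulKmx Bunit u) mulmxBl Bu mul_scalar_mx.
by rewrite subrr mulmx0.
Qed.

Lemma normE_normc {R : realType} (z : R[i]) : `|z| = (Normc.normc z)%:C%C.
Proof. by []. Qed.

Lemma normc_ge0 {R : realType} (z : R[i]) : 0 <= Normc.normc z.
Proof. by case: z => x y; exact: sqrtr_ge0. Qed.

Lemma eigenvalue_normc_le {R : realType} {n} {B : 'M[R]_n} {u : 'cV[R]_n}
    {lambda : R} {z : R[i]} :
  (forall i j, 0 <= B i j) -> (forall i, 0 < u i ord0) ->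
  B *m u = lambda *: u -> complex_spectrum B z -> Normc.normc z <= lambda.
Proof.
move=> B0 u0 Bu /eigenvalueP[w wB wn0].
have wn i : 0 <= Normc.normc (w ord0 i) by exact: normc_ge0.
have wj j : Normc.normc z * Normc.normc (w ord0 j) <=
    \sum_i Normc.normc (w ord0 i) * B i j.
  rewrite -Normc.normcM.
  have -> : z * w ord0 j = \sum_i w ord0 i * (B i j)%:C%C.
    move/rowP: wB => /(_ j); rewrite !mxE => <-.
    by apply: eq_bigr => i _; rewrite !mxE.
  rewrite -lecR -normE_normc rmorph_sum /=.
  apply: le_trans (ler_norm_sum _ _ _) _; apply: ler_sum => i _.
  by rewrite normrM rmorphM /= normE_normc ger0_norm // lecR.
(* Weighting the inequalities [wj] by [u] makes both sides multiples of [S]. *)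
pose S := \sum_j Normc.normc (w ord0 j) * u j ord0.
have S_gt0 : 0 < S.
  have [j wj0] : exists j, w ord0 j != 0.
    apply/existsP; apply: contraR wn0; rewrite negb_exists => /forallP h.
    by apply/eqP/rowP => j; rewrite mxE; apply/eqP; move: (h j); rewrite negbK.
  rewrite /S (bigD1 j) //= ltr_pwDl //; last first.
    by apply: sumr_ge0 => i _; rewrite mulr_ge0 // ltW.
  by rewrite mulr_gt0 // -ltcR -normE_normc normr_gt0.
rewrite -(ler_pM2r S_gt0) /S !mulr_sumr.
apply: (@le_trans _ _
  (\sum_j \sum_i Normc.normc (w ord0 i) * B i j * u j ord0)).
  apply: ler_sum => j _; rewrite mulrA -mulr_suml ler_wpM2r ?wj //.
  by rewrite ltW.
rewrite exchange_big /= ler_sum // => i _.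
have Bui : \sum_j B i j * u j ord0 = lambda * u i ord0.
  by move/colP: Bu => /(_ i); rewrite !mxE.
rewrite mulrCA -Bui mulr_sumr.
by apply: ler_sum => j _; rewrite mulrA.
Qed.

(** This identifies [lambda_PF] without any irreducibility hypothesis. *)
Lemma lambda_PF_pos_eigenvector {R : realType} {n} {B : 'M[R]_n.+1}
    {u : 'cV[R]_n.+1} {lambda : R} :
  (forall i j, 0 <= B i j) -> (forall i, 0 < u i ord0) ->
  B *m u = lambda *: u -> lambda_PF B = lambda.
Proof.
move=> B0 u0 Bu.
have lambda_ge0 : 0 <= lambda.
  rewrite -(pmulr_lge0 _ (u0 ord0)).
  move/colP: Bu => /(_ ord0); rewrite !mxE => <-.
  by apply: sumr_ge0 => j _; rewrite mulr_ge0 // ltW.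
pose E := [set Normc.normc z | z in complex_spectrum B].
have ubE : ubound E lambda.
  by move=> _ [z Bz <-]; exact: eigenvalue_normc_le B0 u0 Bu Bz.
have Elambda : E lambda.
  exists lambda%:C%C; last first.
    by rewrite /= expr0n addr0 sqrtr_sqr ger0_norm.
  apply: (@eigenvalue_col _ _ _ (map_mx (real_complex R) u)).
    apply: contraTneq (u0 ord0) => /colP/(_ ord0); rewrite !mxE => -[->].
    by rewrite ltxx.
  by rewrite -map_mxM Bu map_mxZ.
apply/le_anti/andP; split; first by apply: ge_sup => //; exists lambda.
by apply: ub_le_sup => //; exists lambda.
Qed.

(** * The Perron vector of a positive matrix of order two *)

Lemma forall_ord2 (P : 'I_2 -> Prop) : P ord0 -> P ord_max -> forall i, P i.
Proof.
move=> P0 P1 i; have [->//|i0] := eqVneq i ord0.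
suff -> : i = ord_max by [].
by apply: val_inj; case: i i0 => -[|[|]].
Qed.

Lemma entrysum_sum {R : realType} {n} (u : 'cV[R]_n) :
  entrysum u = \sum_i u i ord0.
Proof.
by rewrite /entrysum mxE; apply: eq_bigr => i _; rewrite !mxE mul1r.
Qed.

Lemma entrysum2 {R : realType} (u : 'cV[R]_2) :
  entrysum u = u ord0 ord0 + u ord_max ord0.
Proof.
rewrite entrysum_sum big_ord_recl big_ord1.
by congr (_ + u _ _); apply: val_inj.
Qed.

Lemma entrysumZ {R : realType} {n} (k : R) (u : 'cV[R]_n) :
  entrysum (k *: u) = k * entrysum u.
Proof. by rewrite /entrysum -scalemxAr mxE. Qed.

Lemma mulmx2E {R : realType} (B : 'M[R]_2) (u : 'cV[R]_2) i :
  (B *m u) i ord0 = B i ord0 * u ord0 ord0 + B i ord_max * u ord_max ord0.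
Proof.
rewrite mxE big_ord_recl big_ord1.
by congr (_ + B _ _ * u _ _); apply: val_inj.
Qed.

(** The larger root [lambda] of the characteristic polynomial exceeds [B00], and
    [(B01, lambda - B00)] is an eigenvector for it. *)
Lemma pos_eigenvector2_exists {R : realType} {B : 'M[R]_2} :
  (forall i j, 0 < B i j) ->
  exists (lambda : R) (v : 'cV[R]_2),
    B *m v = lambda *: v /\ forall i, 0 < v i ord0.
Proof.
move=> B0.
set a := B ord0 ord0; set b := B ord0 ord_max.
set c := B ord_max ord0; set d := B ord_max ord_max.
have b0 : 0 < b by exact: B0.
have bc0 : 0 < b * c by rewrite mulr_gt0 // B0.
pose s := Num.sqrt ((a - d) ^+ 2 + 4 * (b * c)).
have s2 : s ^+ 2 = (a - d) ^+ 2 + 4 * (b * c).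
  by rewrite sqr_sqrtr // addr_ge0 ?sqr_ge0 // mulr_ge0 // ltW.
have s_gt : `|a - d| < s.
  rewrite -sqrtr_sqr ltr_sqrt; first by rewrite ltrDl mulr_gt0.
  by rewrite ltr_wpDl ?sqr_ge0 // mulr_gt0.
have ads : a - d < s by apply: le_lt_trans s_gt; exact: ler_norm.
pose l := (a + d + s) / 2.
exists l, (cv2 b (l - a)); split; last first.
  by apply: forall_ord2; rewrite mxE /= // /l; lra.
have lE : l ^+ 2 = (a + d) * l - (a * d - b * c).
  by rewrite /l; field: s2.
apply/colP; apply: forall_ord2; rewrite mulmx2E !mxE /= -/a -/b -/c -/d.
  by ring.
by ring: lE.
Qed.

Lemma perron_vector2_normalize {R : realType} {B : 'M[R]_2} {v : 'cV[R]_2}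
    {lambda : R} :
  (forall i j, 0 < B i j) -> (forall i, 0 < v i ord0) ->
  B *m v = lambda *: v -> is_perron_vector B ((entrysum v)^-1 *: v).
Proof.
move=> B0 v0 Bv.
have S0 : 0 < entrysum v by rewrite entrysum2 addr_gt0.
split.
- rewrite (lambda_PF_pos_eigenvector _ v0 Bv); last by move=> i j; exact: ltW.
  by rewrite -scalemxAr Bv !scalerA mulrC.
- by move=> i; rewrite mxE mulr_gt0 // invr_gt0.
- by rewrite entrysumZ mulVf // gt_eqF.
Qed.

(** The first row of [B u = lambda u] fixes the ratio of the entries of [u]. *)
Lemma is_perron_vector2_inj {R : realType} {B : 'M[R]_2} {u v : 'cV[R]_2} :
  (forall i j, 0 < B i j) ->
  is_perron_vector B u -> is_perron_vector B v -> u = v.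
Proof.
move=> B0 [Bu _ su] [Bv _ sv].
move/colP: Bu => /(_ ord0); move/colP: Bv => /(_ ord0).
rewrite !mulmx2E !mxE.
move: su sv; rewrite !entrysum2.
set b := B ord0 ord_max; have b0 : b != 0 by rewrite gt_eqF ?B0.
set u0 := u ord0 ord0; set u1 := u ord_max ord0.
set v0 := v ord0 ord0; set v1 := v ord_max ord0 => su sv ev eu.
have uv0 : u0 = v0.
  have /eqP : b * (u0 * v1 - u1 * v0) = 0.
    have -> : b * (u0 * v1 - u1 * v0) =
        u0 * (B ord0 ord0 * v0 + b * v1) - v0 * (B ord0 ord0 * u0 + b * u1).
      by ring.
    by rewrite ev eu; ring.
  rewrite mulf_eq0 (negbTE b0) /= subr_eq0 => /eqP cross.
  by rewrite -[LHS]mulr1 -sv mulrDr cross -mulrDl su mul1r.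
by apply/colP; apply: forall_ord2 => //; rewrite -/u1 -/v1; lra.
Qed.

Lemma perron_vector2_unique {R : realType} {B : 'M[R]_2} :
  (forall i j, 0 < B i j) -> unique (is_perron_vector B) (perron_vector B).
Proof.
move=> B0; have [lambda [v [Bv v0]]] := pos_eigenvector2_exists B0.
have Bpv : is_perron_vector B (perron_vector B).
  exact: (@xgetI _ 0 [set u | is_perron_vector B u] _
            (perron_vector2_normalize B0 v0 Bv)).
by split=> // u; exact: is_perron_vector2_inj.
Qed.

(** * The frozen system *)

Lemma Mmx_unit {R : realType} {theta : param R} :
  (forall j, 0 < theta ord0 j) -> Mmx theta \in unitmx.
Proof.
move=> th0; rewrite unitmxE unitfE (expand_det_row _ ord0) big_ord_recl big_ord1.
rewrite /cofactor !det_mx11 !mxE /= !mul0r addr0 expr0 mul1r.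
by rewrite mulf_neq0 // gt_eqF // th0.
Qed.

Lemma BCA_gt0 {R : realType} {theta : param R} {c a : R} :
  (forall j, 0 < theta ord0 j) -> 0 < c -> 0 <= a ->
  forall i j, 0 < BCA theta c a i j.
Proof.
move=> th0 c0 a0.
pose N := c *: Kmx theta + a *: Dmx theta.
have N0 i j : 0 < N i j.
  rewrite !mxE ltr_pwDl //.
    by rewrite mulr_gt0 //; do 2!case: ifP => _; exact: th0.
  by rewrite mulr_ge0 //; do 2!case: ifP => _ //; exact/ltW/th0.
have MB : Mmx theta *m BCA theta c a = N by rewrite mulKVmx // Mmx_unit.
(* Row [i] of [M B = N] reads [mu_i B i j = N i j]. *)
move=> i j; move: (N0 i j); rewrite -MB mxE big_ord_recl big_ord1.
rewrite [lift _ _](_ : _ = ord_max); last exact: val_inj.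
move: i; apply: forall_ord2; rewrite !mxE /= mul0r ?addr0 ?add0r pmulr_rgt0 //;
  exact: th0.
Qed.

Lemma BCA_fixpoint {R : realType} {theta : param R} (c a : R) (v : 'cV[R]_2) :
  (forall j, 0 < theta ord0 j) ->
  (c *: Kmx theta + a *: Dmx theta - Mmx theta) *m v = 0 <->
  BCA theta c a *m v = v.
Proof.
move=> th0; have Mu := Mmx_unit th0; rewrite mulmxBl /BCA -mulmxA; split.
  by move=> /subr0_eq ->; rewrite mulKmx.
by move=> {2}<-; rewrite mulKVmx // subrr.
Qed.

Lemma entrysum_cv2 {R : realType} (l r : R) : entrysum (cv2 l r) = l + r.
Proof. by rewrite entrysum2 !mxE. Qed.

Lemma cv2_gt0 {R : realType} {l r : R} :
  0 < l -> 0 < r -> forall i, 0 < cv2 l r i ord0.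
Proof. by move=> l0 r0; apply: forall_ord2; rewrite mxE. Qed.

Lemma cv2_perronP {R : realType} {theta : param R} {c a l r : R} :
  (forall j, 0 < theta ord0 j) -> 0 < c -> 0 <= a -> 0 < l -> 0 < r ->
  l + r = qCA c a ->
  BCA theta c a *m cv2 l r = cv2 l r <->
  lambda_PF (BCA theta c a) = 1 /\ cv2 l r = qCA c a *: uCA theta c a.
Proof.
move=> th0 c0 a0 l0 r0 lrq; have B0 := BCA_gt0 th0 c0 a0.
have [[Bu _ _] uniq_u] := perron_vector2_unique B0.
split=> [Bv|[lam1 ->]]; last first.
  by rewrite -scalemxAr Bu lam1 scale1r.
have v0 := cv2_gt0 l0 r0.
have {}Bv : BCA theta c a *m cv2 l r = 1 *: cv2 l r by rewrite scale1r.
split; first by apply: lambda_PF_pos_eigenvector v0 Bv => i j; exact: ltW.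
rewrite /uCA (uniq_u _ (perron_vector2_normalize B0 v0 Bv)) scalerA.
by rewrite entrysum_cv2 -lrq divff ?scale1r // gt_eqF // addr_gt0.
Qed.

Lemma frozen_equilibriumP {R : realType} {theta : param R} {l r a : R} :
  (forall j, 0 < theta ord0 j) -> 0 <= a -> 0 < l -> 0 < r ->
  let c := 1 - l - r - a in 0 < c ->
  frozen_equilibrium theta (l, r, a) <->
  [/\ lambda_PF (BCA theta c a) = 1, scalar_relation theta c a
    & cv2 l r = qCA c a *: uCA theta c a].
Proof.
move=> th0 a0 l0 r0 c c0.
have lrq : l + r = qCA c a by rewrite /qCA /c; ring.
have cE : 1 - entrysum (cv2 l r) - a = c by rewrite entrysum_cv2 /c; ring.
have relE : cv2 l r = qCA c a *: uCA theta c a ->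
    eta_of theta * c - a * entrysum (Dmx theta *m cv2 l r) - rho_of theta * a
      = 0 <-> scalar_relation theta c a.
  move=> ->; rewrite -scalemxAr entrysumZ /scalar_relation.
  by split=> h; [apply/subr0_eq; rewrite -[RHS]h | rewrite h]; ring.
rewrite /frozen_equilibrium /frozen_field cE; split.
  move=> [/(BCA_fixpoint _ _ _ th0)/(cv2_perronP th0 c0 a0 l0 r0 lrq)[lam1 vE]].
  by move=> /(relE vE).
move=> [lam1 /[swap] vE /(relE vE) ->]; congr (_, _).
by apply/(BCA_fixpoint _ _ _ th0)/(cv2_perronP th0 c0 a0 l0 r0 lrq).
Qed.

Theorem proposition2p5 (R : realType) (P : set 'rV[R]_10)
    (P_compact : compact P) (P_convex : convex_set P)
    (P_pos : forall theta, P theta -> forall j, 0 < theta ord0 j)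
    (theta : 'rV[R]_10) (P_theta : P theta) :
  [/\ (* u(C,A) is well defined whenever lambda_PF(B(C,A)) = 1 *)
      forall c a : R, admissible c a -> lambda_PF (BCA theta c a) = 1 ->
        unique (is_perron_vector (BCA theta c a)) (uCA theta c a),
      (* the characterisation of positive frozen equilibria *)
      forall l r a : R, simplex (l, r, a) -> 0 < l -> 0 < r ->
        let c : R := 1 - l - r - a in 0 < c ->
        (frozen_equilibrium theta (l, r, a) <->
         [/\ lambda_PF (BCA theta c a) = 1,
             eta_of theta * c =
               a * (rho_of theta + qCA c a * entrysum (Dmx theta *m uCA theta c a))
           & cv2 l r = qCA c a *: uCA theta c a]),
      (* every positive frozen equilibrium solves the two equations *)
      forall l r a : R, positive_frozen_equilibrium theta (l, r, a) ->
        let c : R := 1 - l - r - a in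
        lambda_PF (BCA theta c a) = 1 /\ scalar_relation theta c a
    & (* each solution of the two equations comes from exactly one positive
         frozen equilibrium, recovered by (L,R) = q(C,A) u(C,A) *)
      forall c a : R, admissible c a ->
        lambda_PF (BCA theta c a) = 1 -> scalar_relation theta c a ->
        forall l r : R,
          (positive_frozen_equilibrium theta (l, r, a) /\ 1 - l - r - a = c) <->
          cv2 l r = qCA c a *: uCA theta c a].
Proof.
have th0 : forall j, 0 < theta ord0 j by exact: P_pos.
split.
- move=> c a [c0 a0 _] _; exact: perron_vector2_unique (BCA_gt0 th0 c0 a0).
- by move=> l r a [_ _ a0 _] l0 r0 c c0; exact: frozen_equilibriumP.
- move=> l r a [[_ _ a0 _] eq l0 r0 c0] /=.
  by have [] := (frozen_equilibriumP th0 a0 l0 r0 c0).1 eq.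
- move=> c a [c0 a0 ca1] lam1 rel l r; split=> [[[_ eq l0 r0 c0'] cE]|vE].
    by rewrite -cE; have [] := (frozen_equilibriumP th0 a0 l0 r0 c0').1 eq.
  have [[_ u_gt0 su] _] := perron_vector2_unique (BCA_gt0 th0 c0 a0).
  have q0 : 0 < qCA c a by rewrite /qCA; lra.
  have v0 i : 0 < cv2 l r i ord0 by rewrite vE mxE mulr_gt0.
  have l0 : 0 < l by move: (v0 ord0); rewrite mxE.
  have r0 : 0 < r by move: (v0 ord_max); rewrite mxE.
  have lrq : l + r = qCA c a.
    by rewrite -entrysum_cv2 vE entrysumZ [entrysum _]su mulr1.
  have cE : 1 - l - r - a = c by move: lrq; rewrite /qCA; lra.
  split=> //; split=> //; [|by apply/frozen_equilibriumP; rewrite ?cE|by rewrite cE].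
  by split; lra.
Qed.
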